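(* Let $d\in\mathbb{N}$. The ring $\mathcal{S}'(\mathbb{Z}^d)$ is not Noetherian.
   Context: $\mathbb{N}=\{1,2,3,\dots\}$. For $\mathbf{n}=(n_1,\dots,n_d)\in\mathbb{Z}^d$ write $|\mathbf{n}|_1:=|n_1|+\cdots+|n_d|$. The set $\mathcal{S}'(\mathbb{Z}^d)$ consists of all maps $\mathbf{a}:\mathbb{Z}^d\to\mathbb{C}$ of at most polynomial growth, i.e. such that there exist a real $M>0$ and $k\in\mathbb{N}$ with $|\mathbf{a}(\mathbf{n})|\le M(1+|\mathbf{n}|_1)^k$ for all $\mathbf{n}\in\mathbb{Z}^d$. With pointwise addition and multiplication it is a commutative unital ring. A commutative ring is Noetherian if every ascending chain of ideals $I_1\subset I_2\subset\cdots$ is stationary. *)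

(* Defs.v *)
From HB Require Import structures.
From mathcomp Require Import all_boot all_order all_algebra.
From mathcomp Require Import all_classical all_reals.
From mathcomp Require Import complex.

Set Implicit Arguments.
Unset Strict Implicit.
Unset Printing Implicit Defensive.

Import Order.TTheory GRing.Theory Num.Theory.

Local Open Scope classical_set_scope.
Local Open Scope ring_scope.
Local Open Scope complex_scope.

Section Noetherian.
Variable A : comPzRingType.

(* The ideals of [ring_quotient] are proper and decidable; here the unit ideal
   is allowed and ideals are arbitrary sets. *)
Definition is_ideal (I : set A) : Prop :=
  [/\ I 0, forall x y, I x -> I y -> I (x + y) & forall a x, I x -> I (a * x)].

Definition noetherian : Prop :=
  forall I : nat -> set A,
    (forall n, is_ideal (I n)) -> (forall n, I n `<=` I n.+1) ->
    exists N, forall n, (N <= n)%N -> I n = I N.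

End Noetherian.

Definition norm1 (d : nat) (n : 'rV[int]_d) : nat := (\sum_(i < d) absz (n 0%R i))%N.

Section Tempered.
Variables (R : rcfType) (d : nat).

Definition poly_growth (a : 'rV[int]_d -> R[i]) : Prop :=
  exists (M : R) (k : nat), [/\ 0 < M, (0 < k)%N &
    forall n, `|a n| <= (M * (1 + (norm1 n)%:R) ^+ k)%:C].

Definition poly_growth_pred : {pred 'rV[int]_d -> R[i]} :=
  fun a => `[< poly_growth a >].

Lemma poly_growth_subring : subring_closed poly_growth_pred.
Proof.
have ge1 (n : 'rV[int]_d) : 1 <= 1 + (norm1 n)%:R :> R by rewrite lerDl.
split.
- apply/asboolP; exists 1, 1%N; split=> // n.
  by rewrite [X in `|X|]/= normr1 mul1r expr1 -[1]/((1 : R)%:C) lecR.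
- move=> a b /asboolP[M [k [M0 k0 Ma]]] /asboolP[N [l [N0 l0 Nb]]].
  apply/asboolP; exists (M + N), (k + l)%N; split=> [||n].
  + exact: addr_gt0.
  + by rewrite addn_gt0 k0.
  + rewrite [X in `|X|]/= (le_trans (ler_normB _ _))//.
    rewrite (le_trans (lerD (Ma n) (Nb n)))// -rmorphD lecR mulrDl lerD//.
      by rewrite ler_wpM2l ?(ltW M0)// ler_weXn2l// leq_addr.
    by rewrite ler_wpM2l ?(ltW N0)// ler_weXn2l// leq_addl.
- move=> a b /asboolP[M [k [M0 k0 Ma]]] /asboolP[N [l [N0 l0 Nb]]].
  apply/asboolP; exists (M * N), (k + l)%N; split=> [||n].
  + exact: mulr_gt0.
  + by rewrite addn_gt0 k0.
  + rewrite [X in `|X|]/= normrM (le_trans (ler_pM _ _ (Ma n) (Nb n)))//.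
    by rewrite -rmorphM exprD mulrACA.
Qed.

HB.instance Definition _ :=
  GRing.isSubringClosed.Build ('rV[int]_d -> R[i]) poly_growth_pred
    poly_growth_subring.

(* The ring S'(Z^d), as a subring of the ring of all maps Z^d -> C with
   pointwise operations. *)
Record tempered : Type := Tempered {
  tempered_fun :> 'rV[int]_d -> R[i];
  _ : tempered_fun \in poly_growth_pred }.

HB.instance Definition _ := [isSub for tempered_fun].
HB.instance Definition _ := [Choice of tempered by <:].
HB.instance Definition _ :=
  GRing.SubChoice_isSubComPzRing.Build ('rV[int]_d -> R[i]) poly_growth_pred
    tempered poly_growth_subring.

End Tempered.

(* Main.v *)
Require Import Defs.
From mathcomp Require Import all_boot all_order all_algebra.
From mathcomp Require Import all_classical all_reals.
From mathcomp Require Import complex.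

(** The sequences vanishing outside the [norm1]-ball of radius [n] form an
    ideal; these ideals increase strictly with [n], because the indicator
    function of a larger ball is bounded, hence tempered. *)

Set Implicit Arguments.
Unset Strict Implicit.
Unset Printing Implicit Defensive.

Import Order.TTheory GRing.Theory Num.Theory.

Local Open Scope classical_set_scope.
Local Open Scope ring_scope.
Local Open Scope complex_scope.

(** A multiple of a basis vector does it. No sphere being empty is what makes each inclusion of
    ideals strict. *)
Lemma norm1_surj (d n : nat) : (0 < d)%N -> exists m : 'rV[int]_d, norm1 m = n.
Proof.
move=> d_gt0; pose i0 := Ordinal d_gt0.
exists (n%:Z *: delta_mx 0 i0); rewrite /norm1 (bigD1 i0)//= big1 => [|i ne_i].
  by rewrite !mxE !eqxx mulr1 addn0.
by rewrite !mxE (negPf ne_i) mulr0.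
Qed.

Section VanishingIdeals.
Variables (R : rcfType) (d : nat).

(** The sphere of radius [n] is already excluded, so supports lie in the open ball and index [0]
    gives the zero ideal. *)
Definition vanishing_from (n : nat) : set (tempered R d) :=
  [set a | forall m, (n <= norm1 m)%N -> a m = 0].

Lemma vanishing_from_ideal (n : nat) : is_ideal (vanishing_from n).
Proof.
split=> [m //|a b a0 b0 m le_nm|a b b0 m le_nm].
  (* The operations of [tempered] are pointwise by conversion, so [//] closes the first equality. *)
  by transitivity (a m + b m); rewrite // (a0 m le_nm) (b0 m le_nm) addr0.
by transitivity (a m * b m); rewrite // (b0 m le_nm) mulr0.
Qed.

Lemma subset_vanishing_from (n : nat) :
  vanishing_from n `<=` vanishing_from n.+1.
Proof. by move=> a a0 m /ltnW; apply: a0. Qed.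

Lemma ball_indicator_poly_growth (n : nat) :
  (fun m : 'rV[int]_d => ((norm1 m <= n)%N)%:R : R[i]) \in
    @poly_growth_pred R d.
Proof.
apply/asboolP; exists 1, 1%N; split=> // m.
(* Both sides are brought into the image of [R] in [R[i]], where the bound reduces to one between
   natural numbers. *)
rewrite mul1r expr1 normr_nat -[X in X <= _](rmorph_nat (real_complex R)) lecR.
by rewrite -(natrD R 1) ler_nat (leq_trans (leq_b1 _)).
Qed.

Definition ball_indicator (n : nat) : tempered R d :=
  Tempered (ball_indicator_poly_growth n).

Lemma ball_indicator_vanishing (n : nat) :
  vanishing_from n.+1 (ball_indicator n).
Proof. by move=> m lt_nm /=; rewrite leqNgt lt_nm. Qed.

(** The closed ball contains a point of norm exactly [n], where the indicator is [1]. *)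
Lemma ball_indicator_not_vanishing (n : nat) :
  (0 < d)%N -> ~ vanishing_from n (ball_indicator n).
Proof.
move=> /norm1_surj-/(_ n)[m norm_m] /(_ m).
by rewrite /= norm_m leqnn => /(_ isT)/eqP; rewrite oner_eq0.
Qed.

End VanishingIdeals.

Theorem proposition2p1 (R : realType) (d : nat) (hd : (0 < d)%N) :
  ~ noetherian (tempered R d).
Proof.
move=> /(_ _ (@vanishing_from_ideal R d) (@subset_vanishing_from R d)).
(* Two consecutive ideals suffice: the indicator of the closed ball of radius [N] separates index
   [N.+1] from [N]. *)
move=> [N /(_ N.+1 (leqnSn N)) eq_ideals].
apply: (@ball_indicator_not_vanishing R d N hd); rewrite -eq_ideals.
exact: ball_indicator_vanishing.
Qed.
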